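(* Let $n$ be a positive integer, let $p<q$ be two prime divisors of $n$, and let $a$ and $b$ be the multiplicities of $p$ and $q$ respectively in the prime factorization of $n$. Let $n^{\star}$ be the integer obtained from $n$ by switching $a$ and $b$, i.e. $n^\star$ has the same prime factorization as $n$ except that $p$ has multiplicity $b$ and $q$ has multiplicity $a$. If $a<b$, then $$n^{\star}<n\quad\text{and}\quad s(n^{\star})>s(n),$$ and if $a>b$, then $$n^{\star}>n\quad\text{and}\quad s(n^{\star})<s(n).$$
   Context: $\sigma(n)=\sum_{d\mid n} d$ and $s(n)=\sigma(n)/n$. *)

(* Defs.v *)
From mathcomp Require Import all_boot all_order all_algebra.

Set Implicit Arguments.
Unset Strict Implicit.
Unset Printing Implicit Defensive.

Definition sigma (n : nat) : nat := \sum_(d <- divisors n) d.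

Definition s (n : nat) : rat := ((sigma n)%:R / n%:R)%R.

Definition switch (p q r : nat) : nat :=
  if r == p then q else if r == q then p else r.

(* Meant for prime divisors p and q of n > 0: the product ranges over the
   primes of n only; see logn_nstar. *)
Definition nstar (p q n : nat) : nat :=
  \prod_(r <- primes n) r ^ logn (switch p q r) n.

Lemma logn_prod_primes (l : seq nat) (f : nat -> nat) (r : nat) :
  uniq l -> all prime l ->
  logn r (\prod_(x <- l) x ^ f x) = if r \in l then f r else 0.
Proof.
elim: l => [|x l IHl] /=; first by rewrite big_nil logn1.
case/andP=> xl ul /andP[px pl]; rewrite big_cons lognM; last 2 first.
- by rewrite expn_gt0 prime_gt0.
- rewrite big_seq; apply: prodn_cond_gt0 => y /(allP pl) py.
  by rewrite expn_gt0 prime_gt0.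
rewrite IHl // inE lognX; case: eqVneq => [->|rx] /=.
  by rewrite (negPf xl) logn_prime // eqxx muln1 addn0.
by rewrite logn_prime // (negPf rx) muln0.
Qed.

Lemma nstar_gt0 (p q n : nat) : 0 < nstar p q n.
Proof.
rewrite /nstar big_seq; apply: prodn_cond_gt0 => y.
by rewrite mem_primes expn_gt0 => /andP[/prime_gt0 ->].
Qed.

Lemma logn_nstar (p q n r : nat) :
  0 < n -> prime p -> p %| n -> prime q -> q %| n ->
  logn r (nstar p q n) =
    if r == p then logn q n else if r == q then logn p n else logn r n.
Proof.
move=> n0 pp pn pq qn; rewrite /nstar logn_prod_primes ?primes_uniq //; last first.
  by apply/allP=> x; rewrite mem_primes => /andP[].
rewrite /switch; case: eqVneq => [->|_]; first by rewrite mem_primes pp n0 pn.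
case: eqVneq => [->|_]; first by rewrite mem_primes pq n0 qn.
by case: ifPn => // /negPf; rewrite -logn_gt0 lt0n => /negbFE /eqP.
Qed.

(* Main.v *)
Require Import Defs.
From mathcomp Require Import all_boot all_order all_algebra.

(**
  Write n = p^a q^b m with m prime to pq, so that the switched integer is
  p^b q^a m. As s is multiplicative and s(p^k) = f(1/p, k), where
  f(x, k) = 1 + x + ... + x^k, the claim reduces to
  f(x, a) f(y, b) < f(x, b) f(y, a) for 0 < y < x and a < b; this follows by
  cancelling f(x, a) f(y, a) and comparing the remaining products term by term:
  x^i y^j < x^j y^i whenever i < j.
*)

Import Order.TTheory GRing.Theory Num.Theory.

(** For coprime [m] and [n], gcds with [m] and [n] invert multiplication: they recover both factors
    of [d * e], and they split any divisor of [m * n]. *)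
Lemma perm_divisorsM (m n : nat) :
  0 < m -> 0 < n -> coprime m n ->
  perm_eq (divisors (m * n)) [seq d * e | d <- divisors m, e <- divisors n].
Proof.
move=> m0 n0 cmn; have mn0 : 0 < m * n by rewrite muln_gt0 m0.
apply: uniq_perm; first exact: divisors_uniq.
  apply: allpairs_uniq; [exact: divisors_uniq | exact: divisors_uniq |].
  move=> [d e] [d' e'] /allpairsP[[x y] /= [xm yn [-> ->]]].
  case/allpairsP=> [[x' y'] /= [x'm y'n [-> ->]]] E.
  move: xm yn x'm y'n; rewrite -!dvdn_divisors // => xm yn x'm y'n.
  have gcd_mul u v : u %| m -> v %| n -> gcdn m (u * v) = u /\ gcdn n (u * v) = v.
    move=> um vn; split.
      by rewrite Gauss_gcdl ?(coprime_dvdr vn) //; apply/gcdn_idPr.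
    by rewrite Gauss_gcdr ?(coprime_dvdr um) 1?coprime_sym //; apply/gcdn_idPr.
  have [E1 E2] := gcd_mul _ _ xm yn; have [E3 E4] := gcd_mul _ _ x'm y'n.
  by congr pair; [rewrite -E1 E E3 | rewrite -E2 E E4].
move=> d; rewrite -dvdn_divisors //; apply/idP/allpairsP => [dmn|].
  exists (gcdn d m, gcdn d n); rewrite /= -!dvdn_divisors // !dvdn_gcdr; split=> //.
  apply/eqP; rewrite eqn_dvd; apply/andP; split.
    rewrite muln_gcdl !muln_gcdr !dvdn_gcd.
    by rewrite dvdn_mulr // dvdn_mulr // dvdn_mull.
  rewrite Gauss_dvd ?dvdn_gcdl //.
  exact: coprime_dvdl (dvdn_gcdr d m) (coprime_dvdr (dvdn_gcdr d n) cmn).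
by case=> [[x y] /= []]; rewrite -!dvdn_divisors // => xm yn ->; apply: dvdn_mul.
Qed.

Lemma sigmaM (m n : nat) :
  0 < m -> 0 < n -> coprime m n -> sigma (m * n) = sigma m * sigma n.
Proof.
move=> m0 n0 cmn; rewrite /sigma (perm_big _ (perm_divisorsM _ _ m0 n0 cmn)) /=.
rewrite big_allpairs_dep big_distrl; apply: eq_bigr => d _.
by rewrite big_distrr.
Qed.

Lemma sigma_pfactor (p k : nat) : prime p -> sigma (p ^ k) = \sum_(i < k.+1) p ^ i.
Proof.
move=> pp; rewrite /sigma -(big_mkord xpredT (expn p)).
rewrite -(big_map (expn p) xpredT id); apply: perm_big.
apply: uniq_perm; first exact: divisors_uniq.
  by rewrite map_inj_uniq ?iota_uniq //; apply/expnI/prime_gt1.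
move=> d; rewrite -dvdn_divisors ?expn_gt0 ?prime_gt0 //.
apply/(dvdn_pfactor _ _ pp)/mapP => [[i ik ->]|[i]].
  by exists i => //; rewrite mem_index_iota ltnS.
by rewrite mem_index_iota ltnS => /andP[_ ik] ->; exists i.
Qed.

Local Open Scope ring_scope.

Lemma sM (m n : nat) :
  (0 < m)%N -> (0 < n)%N -> coprime m n -> s (m * n) = s m * s n.
Proof.
by move=> m0 n0 cmn; rewrite /s sigmaM // !natrM mulf_div.
Qed.

Lemma s_gt0 (n : nat) : (0 < n)%N -> 0 < s n.
Proof.
move=> n0; rewrite divr_gt0 ?ltr0n // /sigma.
rewrite (bigD1_seq n) ?divisors_uniq ?divisors_id //=.
by rewrite addn_gt0 n0.
Qed.

Lemma s_pfactor (p k : nat) :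
  prime p -> s (p ^ k) = \sum_(i < k.+1) (p%:R^-1) ^+ i.
Proof.
move=> pp; have p0 : p%:R != 0 :> rat by rewrite pnatr_eq0 -lt0n prime_gt0.
(* Division by [p ^ k] turns [p ^ (k - i)] into the [i]-th power of [p^-1], hence the reversal of
   the index. *)
rewrite /s sigma_pfactor // natr_sum mulr_suml (reindex_inj rev_ord_inj) /=.
apply: eq_bigr => i _; rewrite subSS !natrX exprVn.
have ik : (i <= k)%N by rewrite -ltnS.
by rewrite expfB_cond ?(negPf p0) // mulrAC divff ?mul1r // expf_neq0.
Qed.

(** Cancelling [x ^+ i * y ^+ i] leaves a comparison of the powers of exponent [j - i > 0]. *)
Lemma ltr_expM_swap (R : realFieldType) (x y : R) (i j : nat) :
  0 < y -> y < x -> (i < j)%N -> x ^+ i * y ^+ j < x ^+ j * y ^+ i.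
Proof.
move=> y0 yx ij; have x0 := lt_trans y0 yx.
rewrite -(subnKC (ltnW ij)) !exprD mulrA [ltRHS]mulrAC.
rewrite ltr_pM2l ?mulr_gt0 ?exprn_gt0 // ltrXn2r ?(ltW y0) //.
by rewrite ?ltW // -lt0n subn_gt0.
Qed.

(** Induction on [b]: each increment adds to the two sides the terms compared in [step]. These
    supply the strictness, so a weak inequality suffices for the rest, and the induction can start
    from [b = a], where the sides agree. *)
Lemma ltr_geometric_swap (R : realFieldType) (x y : R) (a b : nat) :
  0 < y -> y < x -> (a < b)%N ->
  (\sum_(i < a.+1) x ^+ i) * (\sum_(j < b.+1) y ^+ j) <
  (\sum_(j < b.+1) x ^+ j) * (\sum_(i < a.+1) y ^+ i).
Proof.
move=> y0 yx.
have step k : (a < k)%N ->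
    (\sum_(i < a.+1) x ^+ i) * y ^+ k < x ^+ k * (\sum_(i < a.+1) y ^+ i).
  move=> ak; rewrite mulr_suml mulr_sumr; apply: ltr_sum => [|i _].
    (* Strictness of the sum requires at least one term. *)
    by apply/hasP; exists ord0; rewrite ?mem_index_enum.
  by apply: ltr_expM_swap => //; apply: leq_ltn_trans ak; rewrite -ltnS.
elim: b => // b IHb; rewrite ltnS => ab.
rewrite !(big_ord_recr b.+1) /= mulrDr mulrDl.
apply: ler_ltD; last exact: step.
by move: ab; rewrite leq_eqVlt => /predU1P[->|/IHb /ltW].
Qed.

Lemma switch_exponents_lt (p q m a b : nat) :
  prime p -> prime q -> (p < q)%N -> (0 < m)%N -> coprime p m -> coprime q m ->
  (a < b)%N ->
  (p ^ b * q ^ a * m < p ^ a * q ^ b * m)%N /\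
  s (p ^ a * q ^ b * m) < s (p ^ b * q ^ a * m).
Proof.
move=> pp pq lt_pq m0 cpm cqm ab.
have p0 := prime_gt0 pp; have q0 := prime_gt0 pq.
have cpq : coprime p q by rewrite prime_coprime // dvdn_prime2 // ltn_eqF.
have sE i j : s (p ^ i * q ^ j * m) =
    (\sum_(k < i.+1) p%:R^-1 ^+ k) * (\sum_(k < j.+1) q%:R^-1 ^+ k) * s m.
  rewrite sM ?muln_gt0 ?expn_gt0 ?p0 ?q0 // ?coprimeMl ?coprimeXl //.
  by rewrite sM ?expn_gt0 ?p0 ?q0 // ?coprimeXl ?coprimeXr // !s_pfactor.
split; last first.
  (* The common factor [s m] cancels; the rest is the case [x = 1/p], [y = 1/q]. *)
  rewrite !sE ltr_pM2r ?s_gt0 //; apply: ltr_geometric_swap => //.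
    by rewrite invr_gt0 ltr0n.
  by rewrite ltf_pV2 ?posrE ?ltr0n // ltr_nat.
(* After cancelling [p ^ a * q ^ a * m], what remains is [p ^ (b - a) < q ^ (b - a)]. *)
rewrite ltn_pmul2r // -(subnKC (ltnW ab)) !expnD mulnA mulnAC.
by rewrite ltn_pmul2l ?muln_gt0 ?expn_gt0 ?p0 ?q0 // ltn_exp2r // subn_gt0.
Qed.

Local Close Scope ring_scope.

(** Stripping from [n] its power of [p], then that of [q], leaves [m]. The formula for [nstar p q n]
    follows by comparing multiplicities at every [r]. *)
Lemma nstar_decomposition (n p q : nat) :
  0 < n -> prime p -> p %| n -> prime q -> q %| n -> p < q ->
  exists m, [/\ 0 < m, coprime p m, coprime q m,
    n = p ^ logn p n * q ^ logn q n * m &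
    nstar p q n = p ^ logn q n * q ^ logn p n * m].
Proof.
move=> n0 pp pn pq qn lt_pq; have p0 := prime_gt0 pp; have q0 := prime_gt0 pq.
have neq_pq : p != q by rewrite ltn_eqF.
have [k cpk nE] := pfactor_coprime pp n0.
have k0 : 0 < k by move: n0; rewrite nE muln_gt0 => /andP[].
have [m cqm kE] := pfactor_coprime pq k0.
have m0 : 0 < m by move: k0; rewrite kE muln_gt0 => /andP[].
have lk : logn q k = logn q n.
  rewrite nE lognM ?expn_gt0 ?p0 // lognX (logn_prime _ pp).
  by rewrite eq_sym (negPf neq_pq) muln0 addn0.
have cpm : coprime p m by move: cpk; rewrite kE coprimeMr => /andP[].
have nE' : n = p ^ logn p n * q ^ logn q n * m.
  by rewrite {1}nE {1}kE lk mulnC (mulnC m) mulnA.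
have lpm : logn p m = 0 by rewrite logn_coprime.
have lqm : logn q m = 0 by rewrite logn_coprime.
exists m; split=> //.
apply: eqn_from_log; first exact: nstar_gt0.
  by rewrite !muln_gt0 !expn_gt0 p0 q0.
have lognE r i j : logn r (p ^ i * q ^ j * m) =
    i * (r == p) + j * (r == q) + logn r m.
  rewrite !lognM ?muln_gt0 ?expn_gt0 ?p0 ?q0 // !lognX.
  by rewrite (logn_prime _ pp) (logn_prime _ pq).
move=> r; rewrite logn_nstar // lognE.
case: (eqVneq r p) => [->|rp].
  by rewrite (negPf neq_pq) lpm muln1 muln0 !addn0.
case: (eqVneq r q) => [->|rq]; first by rewrite lqm muln0 muln1 addn0.
by rewrite {1}nE' lognE (negPf rp) (negPf rq) !muln0.
Qed.

Theorem theorem2p3 (n p q a b : nat) (hn : 0 < n)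
  (hp : prime p) (hpn : p %| n) (hq : prime q) (hqn : q %| n) (hpq : p < q)
  (ha : a = logn p n) (hb : b = logn q n) :
  (a < b -> nstar p q n < n /\ (s n < s (nstar p q n))%R) /\
  (b < a -> n < nstar p q n /\ (s (nstar p q n) < s n)%R).
Proof.
have [m [m0 cpm cqm]] := nstar_decomposition _ _ _ hn hp hpn hq hqn hpq.
rewrite -ha -hb => nE ->; rewrite nE.
(* The case [b < a] is the same inequality with the roles of [a] and [b] exchanged. *)
by split=> ?; apply: switch_exponents_lt.
Qed.
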